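(* Let $m\geq 2$ and let $\{(A_i,B_i)\}_{i=1}^m$ be a $1$-cross intersecting set pair system with $|A_i|=a_i$ and $|B_i|=b_i$ for every $1\leq i\leq m$. Then $$\sum_{i=1}^{m}\frac{1}{\binom{a_i+b_i}{a_i}}\leq\frac{5}{6}$$ unless for some $1\leq i<j\leq m$ one of the following occurs: (a) $|A_i|=|A_j|=1$ and $B_i\cap B_j\neq\emptyset$; or (b) $|B_i|=|B_j|=1$ and $A_i\cap A_j\neq\emptyset$; or (c) $|A_i|=|A_j|=|B_i|=|B_j|=1$.
   Context: A set pair system is a family $\{(A_i,B_i)\}_{i=1}^m$ of $m\geq 2$ pairs of finite sets. It is $1$-cross intersecting if $A_i\cap B_i=\emptyset$ for all $i$ and $|A_i\cap B_j|=1$ for all distinct $i,j\in[m]$. *)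

(* Defs.v *)
From mathcomp Require Import all_boot all_order all_algebra.
From mathcomp Require Import finmap.

Set Implicit Arguments.
Unset Strict Implicit.
Unset Printing Implicit Defensive.

Local Open Scope fset_scope.

Definition one_cross_intersecting (K : choiceType) (m : nat)
    (A B : 'I_m -> {fset K}) : Prop :=
  (forall i : 'I_m, A i `&` B i = fset0) /\
  (forall i j : 'I_m, i <> j -> #|` A i `&` B j| = 1%N).

(* Main.v *)
(** For a uniformly random ordering of the ground set, [wt a_i b_i] is the probability that
    all of [A_i] precedes all of [B_i], and these events are disjoint.  Conditioning on the
    first point [u] of the ordering expresses the sum as the average over [u] of the sums of
    the links [{(A_i \ u, B_i) : u notin B_i}], which are again 1-cross intersecting and live
    on a smaller ground set; conditioning on the last point is the dual operation.  The
    induction therefore only stops at systems some link of which is exceptional.  If all sets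
    have at least two elements, this forces a pair [A_k = {x,y}], [A_l = {x,z}] with [B_k] and
    [B_l] meeting, and, by duality, a pair [B_i = {x',y'}], [B_j = {x',z'}] with [A_i] and
    [A_j] meeting.  The crossing conditions then prescribe a few elements of every other pair,
    and removing prescribed elements from a family and applying Bollobas' inequality to the
    rest bounds the weight of that family by a small constant. *)

Require Import Defs.
From mathcomp Require Import all_boot all_order all_algebra.
From mathcomp Require Import finmap.
From mathcomp Require Import zify ring lra.

Set Implicit Arguments.
Unset Strict Implicit.
Unset Printing Implicit Defensive.

Import Order.TTheory GRing.Theory Num.Theory.

Local Open Scope ring_scope.

(** * Reciprocal binomial weights and their inequalities *)

Definition wt (a b : nat) : rat := ('C(a + b, a)%:R)^-1.

Lemma wt_gt0 a b : 0 < wt a b.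
Proof. by rewrite invr_gt0 ltr0n bin_gt0 leq_addr. Qed.

Lemma wt_ge0 a b : 0 <= wt a b.
Proof. exact/ltW/wt_gt0. Qed.

Lemma wtC a b : wt a b = wt b a.
Proof. by rewrite /wt addnC -bin_sub ?leq_addl // addnK. Qed.

Lemma wtSl a b : wt a.+1 b = wt a b * a.+1%:R / (a + b).+1%:R.
Proof.
have E : ((a + b).+1%:R * 'C(a + b, a)%:R = a.+1%:R * 'C(a.+1 + b, a.+1)%:R :> rat).
  by rewrite -!natrM mul_bin_diag.
have p1 : ('C(a + b, a)%:R : rat) != 0 by rewrite pnatr_eq0 -lt0n bin_gt0 leq_addr.
have p2 : ('C(a.+1 + b, a.+1)%:R : rat) != 0.
  by rewrite pnatr_eq0 -lt0n bin_gt0 leq_addr.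
have p3 : (a + b).+1%:R != 0 :> rat by rewrite pnatr_eq0.
apply: (mulfI p2); rewrite /wt divff // mulrA mulrCA mulrA -[LHS](divff (mulf_neq0 p3 p1)).
by rewrite {1}E invfM; ring.
Qed.

Lemma wtSr a b : wt a b.+1 = wt a b * b.+1%:R / (a + b).+1%:R.
Proof. by rewrite wtC wtSl wtC addnC. Qed.

Lemma wt_anti a b a' b' : (a <= a')%N -> (b <= b')%N -> wt a' b' <= wt a b.
Proof.
have L x y : wt x.+1 y <= wt x y.
  rewrite wtSl -mulrA ler_piMr ?wt_ge0 // ler_pdivrMr ?ltr0n //.
  by rewrite mul1r ler_nat ltnS leq_addr.
move=> /subnKC <- /subnKC <-.
apply: (@le_trans _ _ (wt a (b + (b' - b)))).
  elim: (a' - a)%N => [|n IH]; first by rewrite addn0.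
  by rewrite addnS; apply: le_trans (L _ _) IH.
elim: (b' - b)%N => [|n IH]; first by rewrite addn0.
by rewrite addnS; apply: le_trans IH; rewrite wtC [leRHS]wtC.
Qed.

Lemma wt_le1 a b : wt a b <= 1.
Proof. by apply: le_trans (wt_anti (leq0n a) (leq0n b)) _; rewrite /wt bin0 invr1. Qed.

Lemma wt_le a b n p q : (p <= a)%N -> (q <= b)%N -> 'C(p + q, p) = n -> wt a b <= n%:R^-1.
Proof. by move=> pa qb <-; apply: wt_anti. Qed.

Lemma natr_le_frac (m n p q : nat) : (0 < n)%N -> (0 < q)%N ->
  (m * q <= p * n)%N -> (m%:R / n%:R <= p%:R / q%:R :> rat).
Proof.
move=> n0 q0 h; rewrite ler_pdivrMr ?ltr0n // mulrAC ler_pdivlMr ?ltr0n //.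
by rewrite -!natrM ler_nat.
Qed.

(** Iterating the one-step recurrences turns the ratio bounds below into polynomial inequalities in
    the two sizes. *)
Lemma wt_ffact a b s t :
  wt (s + a) (t + b) =
    ((s + a) ^_ s * (t + b) ^_ t)%N%:R / ((s + t + (a + b)) ^_ (s + t))%N%:R * wt a b.
Proof.
elim: s => [|s IH].
  rewrite ffactn0 mul1n !add0n; elim: t => [|t IH].
    by rewrite !add0n !ffactn0 divr1 mul1r.
  by rewrite !addSn wtSr IH !ffactnS /= !natrM addnCA invfM; ring.
by rewrite !addSn wtSl IH !ffactnS /= !natrM -addnACA invfM; ring.
Qed.

Lemma wt_ratio a b s t n d : (0 < d)%N -> (s <= a)%N -> (t <= b)%N ->
  (d * (a ^_ s * b ^_ t) <= n * (a + b) ^_ (s + t))%N ->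
  wt a b <= n%:R / d%:R * wt (a - s) (b - t).
Proof.
move=> d0 sa tb h; rewrite -{1}(subnKC sa) -{1}(subnKC tb) wt_ffact addnACA !subnKC //.
rewrite ler_wpM2r ?wt_ge0 //; apply: natr_le_frac; rewrite // 1?mulnC //.
by rewrite ffact_gt0 leq_add.
Qed.
(** The constant is the ratio at [a = b = 2]; once these sizes are excluded it drops to 3/10, the
    ratio at sizes 2 and 3. *)
Lemma wt_ratio11 a b : (2 <= a)%N -> (2 <= b)%N ->
  wt a b <= 1%:R / 3%:R * wt (a - 1) (b - 1).
Proof.
move=> a2 b2; apply: wt_ratio; rewrite ?(ltnW a2) ?(ltnW b2) //.
rewrite !ffactnS !ffactn0 !muln1 mul1n -(subnKC a2) -(subnKC b2) !addSn /=.
nia.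
Qed.

Lemma wt_ratio11_strict a b : (2 <= a)%N -> (2 <= b)%N -> (5 <= a + b)%N ->
  wt a b <= 3%:R / 10%:R * wt (a - 1) (b - 1).
Proof.
move=> a2 b2 ab; apply: wt_ratio; rewrite ?(ltnW a2) ?(ltnW b2) //.
rewrite !ffactnS !ffactn0 !muln1.
(* The bound [4ab <= (a + b)^2] suffices from [a + b = 6] on; the sum 5 is checked by hand. *)
have [AGM _] := nat_AGM2 a b; case: (ltnP 5 (a + b)) => ab'.
  rewrite -mulnn in AGM; move: (a * b)%N (a + b)%N AGM ab' => m s {ab}.
  by case: s => // s; rewrite succnK => AGM s5; have := leq_mul (leqnn s.+1) (s5 : (5 <= s)%N); lia.
have: a = 2%N /\ b = 3%N \/ a = 3%N /\ b = 2%N by clear AGM; lia.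
by case=> -[-> ->].
Qed.

Lemma wt_ratio12 a b : (2 <= a)%N -> (2 <= b)%N ->
  wt a b <= 1%:R / 5%:R * wt (a - 1) (b - 2).
Proof.
move=> a2 b2; apply: wt_ratio; rewrite ?(ltnW a2) ?(ltnW b2) //.
rewrite !ffactnS !ffactn0 !muln1 mul1n.
rewrite -(subnKC a2) -(subnKC b2); move: (a - 2)%N (b - 2)%N => p q.
rewrite !addSn !addnS !add0n /=.
case: (posnP p) => [->|p0]; first by case: (ltnP 1 q) => q1; nia.
rewrite -(prednK p0); move: p.-1 => u.
(* with b = q + 2, four times the difference is b (2b - 2u - 9)^2 plus nonnegative terms *)
have h : 0 <= q.+2%:Z * ((2 * q%:Z - 2 * u%:Z - 5) * (2 * q%:Z - 2 * u%:Z - 5)).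
  by apply: mulr_ge0 => //; apply: sqr_ge0.
nia.
Qed.

Lemma wt_ratio13 a b : (2 <= a)%N -> (3 <= b)%N ->
  wt a b <= 1%:R / 6%:R * wt (a - 1) (b - 3).
Proof.
move=> a2 b3; apply: wt_ratio; rewrite ?(ltnW a2) ?(ltnW b2) //.
rewrite !ffactnS !ffactn0 !muln1 mul1n.
rewrite -(subnKC a2) -(subnKC b3); move: (a - 2)%N (b - 3)%N => p q.
rewrite !addSn !addnS !add0n /=.
have h : 0 <= (q%:Z * q%:Z) * ((q%:Z - p%:Z) * (q%:Z - p%:Z)).
  by apply: mulr_ge0 => //; apply: sqr_ge0.
have h' : (q * q <= q * q * q)%N by case: q {h} => // q; rewrite leq_pmulr.
nia.
Qed.

Lemma wt_ratio22 a b : (2 <= a)%N -> (2 <= b)%N ->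
  wt a b <= 1%:R / 6%:R * wt (a - 2) (b - 2).
Proof.
move=> a2 b2; apply: wt_ratio; rewrite // !ffactnS !ffactn0 !muln1 mul1n.
rewrite -(subnKC a2) -(subnKC b2); move: (a - 2)%N (b - 2)%N => p q.
rewrite !addSn !addnS !add0n /=.
nia.
Qed.

Lemma wt_ratio22_strict a b : (2 <= a)%N -> (2 <= b)%N -> (5 <= a + b)%N ->
  wt a b <= 1%:R / 10%:R * wt (a - 2) (b - 2).
Proof.
move=> a2 b2 ab; apply: wt_ratio; rewrite // !ffactnS !ffactn0 !muln1 mul1n.
move: ab; rewrite -(subnKC a2) -(subnKC b2); move: (a - 2)%N (b - 2)%N => p q.
rewrite !addSn !addnS !add0n /= => pq.
have h : 0 <= (p%:Z * q%:Z) * ((q%:Z - p%:Z) * (q%:Z - p%:Z)).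
  by apply: mulr_ge0 => //; apply: sqr_ge0.
have h' : 0 <= (q%:Z - p%:Z) * (q%:Z - p%:Z) by apply: sqr_ge0.
case: p pq h h' => [|p] pq h h'; first by case: q pq h h' => [|q] //= _ _ _; nia.
case: q pq h h' => [|q] pq h h'; nia.
Qed.

(** With [p], [q], [n] the falling factorials of length 2 of [a], [b], [a + b], the two terms on the
    right are [n / p] and [n / q] times [wt a b]. For [a = b] the sum of these ratios tends to 8
    from above, so 8 is the best constant. *)
Lemma wt_split_le a b : (2 <= a)%N -> (2 <= b)%N ->
  8%:R * wt a b <= wt (a - 2) b + wt a (b - 2).
Proof.
move=> a2 b2.
have PQ : (8 * (a ^_ 2 * b ^_ 2) <= (a + b) ^_ 2 * (a ^_ 2 + b ^_ 2))%N.
  rewrite !ffactnS !ffactn0 !muln1 -(subnK a2) -(subnK b2).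
  move: (a - 2)%N (b - 2)%N => p q; rewrite addnACA !addn2 !succnK (addnS _ 3) succnK.
  have h : 0 <= (q%:Z - p%:Z) * (q%:Z - p%:Z) by apply: sqr_ge0.
  have h2 : 0 <= (p%:Z * q%:Z) * ((q%:Z - p%:Z) * (q%:Z - p%:Z)).
    exact: mulr_ge0.
  have h3 : 0 <= (q%:Z * q%:Z - p%:Z * p%:Z) * (q%:Z * q%:Z - p%:Z * p%:Z).
    exact: sqr_ge0.
  have h4 : 0 <= (q%:Z + p%:Z) * ((q%:Z - p%:Z) * (q%:Z - p%:Z)).
    by apply: mulr_ge0 => //; apply: addr_ge0.
  have h5 := (leq0n (p * p), leq0n (q * q), leq0n (p * p * p), leq0n (q * q * q)).
  case: h5 => [[[h5 h6] h7] h8]; lia.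
have := wt_ffact (a - 2) b 2 0; have := wt_ffact a (b - 2) 0 2.
rewrite !add0n !addn0 ffactn0 mul1n muln1 [(2 + (b - 2))%N]subnKC //.
rewrite [(2 + (a + _))%N]addnCA [(2 + (_ + b))%N]addnA !subnKC //.
move: (wt_gt0 a b) PQ; move: (wt a b) (wt (a - 2) b) (wt a (b - 2)) => W X Y W0.
have: (0 < a ^_ 2)%N && (0 < b ^_ 2)%N && (0 < (a + b) ^_ 2)%N.
  by rewrite !ffact_gt0 a2 b2 (leq_trans a2) ?leq_addr.
move: (a ^_ 2) (b ^_ 2) ((a + b) ^_ 2) => p q n.
rewrite -(ltr0n rat) -[(0 < q)%N](ltr0n rat) -[(0 < n)%N](ltr0n rat).
rewrite -(ler_nat rat) !natrM natrD.
move: (p%:R) (q%:R) (n%:R) => {}p {}q {}n /andP[/andP[p0 q0] n0] h EY EX.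
have -> : X = W * (n / p) by rewrite EX; field; rewrite !gt_eqF.
have -> : Y = W * (n / q) by rewrite EY; field; rewrite !gt_eqF.
rewrite -mulrDr mulrC ler_pM2l //.
have -> : n / p + n / q = n * (p + q) / (p * q) by field; rewrite !gt_eqF.
by rewrite ler_pdivlMr ?mulr_gt0.
Qed.

(** * Cross intersecting families, links and Bollobas' inequality *)

Section SetPairs.

Variables I V : finType.
Implicit Types (J P : {set I}) (A B : I -> {set V}) (S T Y : {set V}) (c : rat).

(** The family lives on a subset [J] of a fixed index type, so that links and subfamilies only
    shrink [J]. *)
Definition cross J A B : Prop :=
  (forall i, i \in J -> A i :&: B i = set0) /\
  (forall i j, i \in J -> j \in J -> i != j -> #|A i :&: B j| = 1%N).

Definition fsum J A B : rat := \sum_(i in J) wt #|A i| #|B i|.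

Lemma cross_sym J A B : cross J A B -> cross J B A.
Proof.
move=> [dis one]; split=> [i iJ|i j iJ jJ ij]; first by rewrite setIC dis.
by rewrite setIC one // eq_sym.
Qed.

Lemma fsum_sym J A B : fsum J A B = fsum J B A.
Proof. by apply: eq_bigr => i _; rewrite wtC. Qed.

Lemma cross_sub J P A B : P \subset J -> cross J A B -> cross P A B.
Proof.
move=> /subsetP PJ [dis one]; split=> [i /PJ|i j /PJ iJ /PJ jJ]; [exact: dis|exact: one].
Qed.

Lemma cross_disjoint J A B i x : cross J A B -> i \in J ->
  x \in A i -> x \in B i -> False.
Proof. by move=> [dis _] iJ xA xB; have := in_setI x (A i) (B i); rewrite dis // inE xA xB. Qed.

Lemma cross_inj J A B i j x y : cross J A B -> i \in J -> j \in J -> i != j ->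
  x \in A i -> x \in B j -> y \in A i -> y \in B j -> x = y.
Proof.
move=> [_ one] iJ jJ ij xA xB yA yB; have /eqP/cards1P[z E] := one _ _ iJ jJ ij.
have : x \in A i :&: B j by rewrite inE xA xB.
have : y \in A i :&: B j by rewrite inE yA yB.
by rewrite E !inE => /eqP-> /eqP->.
Qed.

Lemma cross_meet J A B i j : cross J A B -> i \in J -> j \in J -> i != j ->
  exists2 x, x \in A i & x \in B j.
Proof.
move=> [_ one] iJ jJ ij; have /eqP/cards1P[z E] := one _ _ iJ jJ ij.
have /setIP[] : z \in A i :&: B j by rewrite E inE.
by exists z.
Qed.

Lemma eq_cross J A B A' B' :
  (forall i j, i \in J -> j \in J -> A' i :&: B' j = A i :&: B j) ->
  cross J A B -> cross J A' B'.
Proof.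
by move=> E [dis one]; split=> [i iJ|i j iJ jJ ij]; rewrite E //; [exact: dis|exact: one].
Qed.

(** The deleted elements lie in no intersection of an [A i] with a [B j], so all these intersections
    stay the same. *)
Lemma cross_setD J A B S T : cross J A B ->
  (forall i x, i \in J -> x \in S -> x \notin B i) ->
  (forall i x, i \in J -> x \in T -> x \notin A i) ->
  cross J (fun i => A i :\: S) (fun i => B i :\: T).
Proof.
move=> crs SB TA; apply: eq_cross crs => i j iJ jJ; apply/setP => x; rewrite !inE.
case: (boolP (x \in S)) => [/SB-/(_ _ jJ)/negbTE->|_]; first by rewrite !andbF.
by case: (boolP (x \in T)) => [/TA-/(_ _ iJ)/negbTE->|_].
Qed.

(* The system seen after conditioning on [u] being the first point of the ordering; its
   first components are the sets [A i :\ u]. *)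
Definition link u J B : {set I} := [set i in J | u \notin B i].

Lemma link_sub u J B : link u J B \subset J.
Proof. by apply/subsetP => i /setIdP[]. Qed.

Lemma cross_link u J A B : cross J A B -> cross (link u J B) (fun i => A i :\ u) B.
Proof.
move=> crs; apply: eq_cross (cross_sub (link_sub u J B) crs) => i j _.
rewrite inE => /andP[_ uB]; apply/setP => x; rewrite !inE.
by have [->|_] := eqVneq x u; rewrite ?(negbTE uB) ?andbF.
Qed.

(** Exchange the sums. A fixed [i] of sizes [a], [b] contributes [wt (a - 1) b] for each [u] in
    [A i], nothing for [u] in [B i], and [wt a b] for each other [u]. Since
    [a * wt (a - 1) b = (a + b) * wt a b] for [a > 0], the total is [#|Y|] times [wt a b]. *)
Lemma averaging Y J A B : cross J A B ->
  (forall i, i \in J -> A i :|: B i \subset Y) -> (forall i, i \in J -> A i != set0) ->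
  #|Y|%:R * fsum J A B = \sum_(u in Y) fsum (link u J B) (fun i => A i :\ u) B.
Proof.
move=> crs sub A0; rewrite /fsum mulr_sumr.
rewrite (exchange_big_dep (mem J)) => [|u i _ /setIdP[]] //=.
apply: eq_bigr => i iJ; have /(_ i iJ) := sub; rewrite subUset => /andP[AY BY].
have dis : [disjoint A i & B i] by rewrite -setI_eq0 (proj1 crs).
have a0 : (0 < #|A i|)%N by rewrite card_gt0 A0.
rewrite (eq_bigl (fun u => (u \in A i) || (u \in Y :\: (A i :|: B i)))); last first.
  move=> u; rewrite !inE iJ /=; case: (boolP (u \in A i)) => uA /=.
    rewrite (subsetP AY u uA) /=; apply/negP => uB.
    exact: cross_disjoint crs iJ uA uB.
  by rewrite andbC.
rewrite bigU /=; last first.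
  by rewrite disjoints_subset; apply/subsetP => u uA; rewrite !inE uA.
rewrite (eq_bigr (fun _ => wt #|A i|.-1 #|B i|)); last first.
  by move=> u uA; rewrite (cardsD1 u (A i)) uA.
rewrite [X in _ = _ + X](eq_bigr (fun _ => wt #|A i| #|B i|)); last first.
  move=> u; rewrite !inE => /andP[]; rewrite negb_or => /andP[uA _] _.
  by rewrite (cardsD1 u (A i)) (negbTE uA).
rewrite !sumr_const cardsD (setIidPr (sub i iJ)) cardsU (disjoint_setI0 dis) cards0 subn0.
have le : (#|A i| + #|B i| <= #|Y|)%N.
  have := subset_leq_card (sub i iJ).
  by rewrite cardsU (disjoint_setI0 dis) cards0 subn0.
have -> : #|Y|%:R = (#|Y| - (#|A i| + #|B i|))%:R + (#|A i| + #|B i|)%:R :> rat.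
  by rewrite -natrD subnK.
move: (#|A i|) (#|B i|) a0 (_ - _)%N {le} => a b a0 d.
rewrite mulrDl addrC [d%:R * _]mulr_natl; congr (_ + _).
case: a a0 => // a _; rewrite wtSl addSn succnK -[RHS]mulr_natl.
by rewrite [LHS]mulrC divfK 1?mulrC // pnatr_eq0.
Qed.

Lemma cross_neq0 J A B i : cross J A B -> (1 < #|J|)%N -> i \in J -> A i != set0.
Proof.
move=> crs J1 iJ; have : (0 < #|J :\ i|)%N by move: J1; rewrite (cardsD1 i) iJ.
move/card_gt0P=> [j /setD1P[ji jJ]]; apply/set0Pn.
by have [|x xA _] := cross_meet crs iJ jJ; rewrite 1?eq_sym //; exists x.
Qed.

Definition supp J A B : {set V} := \bigcup_(i in J) (A i :|: B i).

Lemma supp_link u J A B : u \in supp J A B ->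
  (#|supp (link u J B) (fun i => (A i) :\ u) B| < #|supp J A B|)%N.
Proof.
move=> uS; apply: proper_card; apply/properP; split; last first.
  exists u => //; apply/bigcupP => -[i /setIdP[iJ /negbTE uB]].
  by rewrite !inE eqxx uB.
apply/subsetP => x /bigcupP[i /setIdP[iJ _]]; rewrite !inE => xi.
by apply/bigcupP; exists i; rewrite // inE; case/orP: xi => [/andP[_ ->]|->]; rewrite ?orbT.
Qed.

(** The sum is the average of the link sums over the support, hence at most any common upper bound
    for them. *)
Lemma fsum_le_link J A B c : cross J A B -> (1 < #|J|)%N ->
  (forall u, u \in supp J A B -> fsum (link u J B) (fun i => A i :\ u) B <= c) ->
  fsum J A B <= c.
Proof.
move=> crs J1 le; have A0 i := cross_neq0 crs J1 (i := i).
have sub i : i \in J -> A i :|: B i \subset supp J A B by move=> iJ; apply: (bigcup_max i).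
have S0 : (0 < #|supp J A B|)%N.
  have [i iJ] : exists i, i \in J by apply/card_gt0P/ltnW.
  have /set0Pn[x xA] := A0 i iJ; apply/card_gt0P; exists x.
  by apply: (subsetP (sub i iJ)); rewrite inE xA.
have S0' : 0 < #|supp J A B|%:R :> rat by rewrite ltr0n.
rewrite -(ler_pM2l S0') (averaging crs sub A0) mulr_natl -sumr_const.
exact: ler_sum.
Qed.

Lemma fsum_small J A B c : 0 <= c -> (#|J| <= 1)%N ->
  (forall i, i \in J -> wt #|A i| #|B i| <= c) -> fsum J A B <= c.
Proof.
move=> c0; rewrite leq_eqVlt ltnS leqn0 => /orP[/cards1P[i ->] le|].
  by rewrite /fsum big_set1 le // inE.
by rewrite cards_eq0 => /eqP -> _; rewrite /fsum big_set0.
Qed.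

(** Induction on the size of the support: links lose the point [u], and the recursion stops at
    families with at most one pair. *)
Lemma bollobas J A B : cross J A B -> fsum J A B <= 1.
Proof.
have [n] := ubnP #|supp J A B|; elim: n J A => [J A|n IH J A]; [by rewrite ltn0|rewrite ltnS => Sn crs].
case: (ltnP 1 #|J|) => J1; last by apply: fsum_small => // i _; apply: wt_le1.
apply: fsum_le_link => // u uS; apply: IH (cross_link _ crs).
exact: leq_trans (supp_link uS) Sn.
Qed.

(** * Families with prescribed elements *)

Lemma fsum_setD_le1 P A B S T : cross P A B ->
  (forall i x, i \in P -> x \in S -> x \notin B i) ->
  (forall i x, i \in P -> x \in T -> x \notin A i) ->
  \sum_(i in P) wt #|A i :\: S| #|B i :\: T| <= 1.
Proof. by move=> crs SB TA; apply: bollobas (cross_setD crs SB TA). Qed.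

(** Disjointness keeps [S] out of every [B i] and [T] out of every [A i], so both can be deleted
    without harming the crossing condition; Bollobas' inequality bounds the reduced weights by 1. *)
Lemma fsum_ratio n d P A B S T : cross P A B ->
  (forall i, i \in P -> S \subset A i) -> (forall i, i \in P -> T \subset B i) ->
  (forall i, i \in P ->
     wt #|A i| #|B i| <= n%:R / d%:R * wt (#|A i| - #|S|) (#|B i| - #|T|)) ->
  fsum P A B <= n%:R / d%:R.
Proof.
move=> crs SA TB le; rewrite -[leRHS]mulr1; set c := n%:R / d%:R in le *.
have c0 : 0 <= c by rewrite divr_ge0 ?ler0n.
have := fsum_setD_le1 (S := S) (T := T) crs; set X := \sum_(i in P) _ => X1.
apply: (@le_trans _ _ (c * X)).
  rewrite mulr_sumr; apply: ler_sum => i iP; apply: le_trans (le i iP) _.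
  by rewrite !cardsD !(setIidPr _) ?SA ?TB.
apply: ler_wpM2l => //; apply: X1 => i x iP xS; apply/negP => xB.
  exact: cross_disjoint crs iP (subsetP (SA i iP) _ xS) xB.
exact: cross_disjoint crs iP xB (subsetP (TB i iP) _ xS).
Qed.

Lemma fsumD1 J A B i : i \in J -> fsum J A B = wt #|A i| #|B i| + fsum (J :\ i) A B.
Proof. exact: big_setD1. Qed.

Lemma fsumID (q : pred I) J A B :
  fsum J A B = fsum [set p in J | q p] A B + fsum [set p in J | ~~ q p] A B.
Proof.
rewrite /fsum (bigID q) /=.
by congr (_ + _); apply: eq_bigl => p; rewrite inE.
Qed.

(** * Two-element sets and forks *)

Lemma set2_eq (S : {set V}) u v : #|S| = 2%N -> u \in S -> v \in S -> u != v -> S = [set u; v].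
Proof.
move=> S2 uS vS uv; apply/esym/eqP; rewrite eqEcard S2 cards2 uv leqnn andbT.
by apply/subsetP => t /set2P[] ->.
Qed.

(** [B p] meets the two-element set [A i] in exactly one point. *)
Lemma pair_xor J A B i p u v : cross J A B -> i \in J -> p \in J -> i != p ->
  A i = [set u; v] -> u != v -> (v \in B p) = (u \notin B p).
Proof.
move=> crs iJ pJ ip E uv; have [uA vA] : u \in A i /\ v \in A i by rewrite E !inE !eqxx orbT.
apply/idP/idP => [vB|uB].
  by apply: contra uv => uB; apply/eqP; apply: cross_inj crs iJ pJ ip uA uB vA vB.
by have [t] := cross_meet crs iJ pJ ip; rewrite E => /set2P[] -> //; rewrite (negbTE uB).
Qed.

(* The only way in which the link at [x] can become exceptional when all sets [A i] have at
   least two elements; [y] and [z] exist by the crossing condition. *)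
Record forked J A B k l x y z w : Prop := Forked {
  forked_k : k \in J; forked_l : l \in J; forked_neq : k != l;
  forked_Ak : A k = [set x; y]; forked_Al : A l = [set x; z];
  forked_zBk : z \in B k; forked_wBk : w \in B k;
  forked_yBl : y \in B l; forked_wBl : w \in B l }.

Lemma forked_sym J A B k l x y z w : forked J A B k l x y z w -> forked J A B l k x z y w.
Proof. by case=> *; split; rewrite // eq_sym. Qed.

Lemma forked_dist J A B k l x y z w : cross J A B -> forked J A B k l x y z w ->
  [/\ x != y, x != z, y != z & [/\ w != x, w != y & w != z]].
Proof.
move=> crs [kJ lJ kl Ak Al zBk wBk yBl wBl].
have Nk v : v \in B k -> v \notin [set x; y].
  by move=> vB; rewrite -Ak; apply/negP => vA; apply: cross_disjoint crs kJ vA vB.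
have Nl v : v \in B l -> v \notin [set x; z].
  by move=> vB; rewrite -Al; apply/negP => vA; apply: cross_disjoint crs lJ vA vB.
move: (Nk _ zBk) (Nk _ wBk) (Nl _ yBl) (Nl _ wBl); rewrite !inE !negb_or.
move=> /andP[zx zy] /andP[wx wy] /andP[yx _] /andP[_ wz].
by split=> //; rewrite eq_sym.
Qed.

Lemma forkedE J A B k l x y z w p : cross J A B -> forked J A B k l x y z w ->
  p \in J -> p != k -> p != l -> (y \in B p = (x \notin B p)) * (z \in B p = (x \notin B p)).
Proof.
move=> crs F pJ pk pl; have [xy xz _ _] := forked_dist crs F.
split; first by apply: (pair_xor crs (forked_k F)); rewrite // 1?eq_sym // (forked_Ak F).
by apply: (pair_xor crs (forked_l F)); rewrite // 1?eq_sym // (forked_Al F).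
Qed.

(** Here [B k = {z, w}], and [z] lies in [B p], hence not in [A p]; so [A p] must meet [B k] in
    [w]. *)
Lemma forked_B2 J A B k l x y z w p : cross J A B -> forked J A B k l x y z w ->
  p \in J -> p != k -> p != l -> #|B k| = 2%N -> x \notin B p -> w \in A p.
Proof.
move=> crs F pJ pk pl Bk2 xp; have [_ _ _ [_ _ wz]] := forked_dist crs F.
have zBp : z \in B p by rewrite (forkedE crs F).
have Bk : B k = [set z; w].
  by apply: set2_eq => //; rewrite 1?eq_sym // ?(forked_zBk F) ?(forked_wBk F).
rewrite (pair_xor (cross_sym crs) (forked_k F) pJ _ Bk) 1?eq_sym //.
by apply/negP => zA; apply: cross_disjoint crs pJ zA zBp.
Qed.

(** * A fork beside a singleton on the other side *)

Lemma wt_le11 a b : (1 <= a)%N -> (1 <= b)%N -> wt a b <= 2^-1.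
Proof. by move=> a1 b1; apply: wt_le a1 b1 erefl. Qed.

Lemma wt_le21 a b : (2 <= a)%N -> (1 <= b)%N -> wt a b <= 3^-1.
Proof. by move=> a2 b1; apply: wt_le a2 b1 erefl. Qed.

Lemma wt_le22 a b : (2 <= a)%N -> (2 <= b)%N -> wt a b <= 6^-1.
Proof. by move=> a2 b2; apply: wt_le a2 b2 erefl. Qed.

Lemma wt_le23 a b : (2 <= a)%N -> (3 <= b)%N -> wt a b <= 10^-1.
Proof. by move=> a2 b3; apply: wt_le a2 b3 erefl. Qed.

(** The single point of [B i] lies in all other first components, which forces it to be [x]. So
    every remaining [A p] contains [x] and every remaining [B p] contains [y] and [z]. *)
Lemma fork_with_singleton J A B k l x y z w i : cross J A B -> forked J A B k l x y z w ->
  (forall p, p \in J -> (2 <= #|A p|)%N) -> i \in J -> #|B i| = 1%N ->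
  fsum J A B <= 5 / 6.
Proof.
move=> crs F A2 iJ /eqP/cards1P[b Bi].
have [xy xz yz [wx wy wz]] := forked_dist crs F.
have [kJ lJ kl Ak Al zBk wBk yBl wBl] := F.
have ki : k != i.
  by apply: contraNneq wz => E; move: zBk wBk; rewrite E Bi !inE => /eqP-> /eqP->.
have li : l != i.
  by apply: contraNneq wy => E; move: yBl wBl; rewrite E Bi !inE => /eqP-> /eqP->.
have bA p : p \in J -> p != i -> b \in A p.
  by move=> pJ pi; have [t tA] := cross_meet crs pJ iJ pi; rewrite Bi inE => /eqP <-.
(* The point lies in both [A k] and [A l]; it is not [y], because [y] is in [B l]. *)
have bx : b = x.
  have := bA _ kJ ki; rewrite Ak => /set2P[] // by_.
  case: (cross_disjoint crs lJ (bA _ lJ li)); by rewrite by_.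
move: bA Bi; rewrite {b}bx => xA_ Bi; pose R := J :\ i :\ k :\ l.
have RP p : p \in R -> [/\ p \in J, p != k, p != l & x \in A p].
  by rewrite !inE => /and4P[pl pk pi pJ]; split=> //; apply: xA_.
have RB p : p \in R -> x \notin B p.
  by case/RP=> pJ _ _ xA; apply/negP; apply: cross_disjoint crs pJ xA.
have crsR : cross R A B by apply: cross_sub crs; apply/subsetP => p /RP[].
have RT p : p \in R -> [set y; z] \subset B p.
  move=> pR; have [pJ pk pl _] := RP p pR; have E := forkedE crs F pJ pk pl.
  by apply/subsetP => v /set2P[] ->; rewrite E RB.
have R2 p : p \in R -> (2 <= #|A p|)%N /\ (2 <= #|B p|)%N.
  move=> pR; split; first by case: (RP p pR) => /A2.
  by have := subset_leq_card (RT p pR); rewrite cards2 yz.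
have Bk2 : (2 <= #|B k|)%N by apply/card_gt1P; exists z, w; rewrite eq_sym.
have Bl2 : (2 <= #|B l|)%N by apply/card_gt1P; exists y, w; rewrite eq_sym.
have -> : fsum J A B = wt #|A i| #|B i| + (wt #|A k| #|B k| + (wt #|A l| #|B l| + fsum R A B)).
  by do 3![rewrite -fsumD1 ?inE ?kJ ?lJ ?ki ?li ?iJ 1?eq_sym ?kl //].
have wi : wt #|A i| #|B i| <= 3^-1 by apply: wt_le21; rewrite ?A2 // Bi cards1.
have R5 : fsum R A B <= 1%:R / 5%:R.
  apply: (fsum_ratio (S := [set x]) (T := [set y; z]) crsR) => p pR; last first. 
  - by rewrite cards1 cards2 yz; apply: wt_ratio12; case: (R2 p pR).
  - exact: RT.
  - by rewrite sub1set; case: (RP p pR).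
have R6 : #|B k| = 2%N \/ #|B l| = 2%N -> fsum R A B <= 1%:R / 6%:R.
  move=> B2; apply: (fsum_ratio (S := [set x; w]) (T := [set y; z]) crsR) => p pR; last first. 
  - by rewrite !cards2 yz eq_sym wx; apply: wt_ratio22; case: (R2 p pR).
  - exact: RT.
  have [pJ pk pl xA] := RP p pR; apply/subsetP => v /set2P[] -> //.
  case: B2 => B2; first by rewrite (forked_B2 crs F) ?RB.
  by rewrite (forked_B2 crs (forked_sym F)) ?RB.
have := wt_le22 (A2 k kJ) Bk2; have := wt_le22 (A2 l lJ) Bl2.
(* If [B k] or [B l] has two elements, [w] is prescribed too and the sum is at most
   [1/3 + 1/6 + 1/6 + 1/6 = 5/6]. Otherwise it is at most [1/3 + 1/10 + 1/10 + 1/5]. *)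
case: (ltnP 2 #|B k|) => Bk3; last first.
  have /R6 : #|B k| = 2%N \/ #|B l| = 2%N by left; apply/eqP; rewrite eqn_leq Bk3.
  lra.
case: (ltnP 2 #|B l|) => Bl3; last first.
  have /R6 : #|B k| = 2%N \/ #|B l| = 2%N by right; apply/eqP; rewrite eqn_leq Bl3.
  lra.
have := wt_le23 (A2 k kJ) Bk3; have := wt_le23 (A2 l lJ) Bl3; lra.
Qed.

(** * Opposite forks with common indices *)

(** Both forks sit on [i] and [j], with [A i = {w, z}], [A j = {w, y}], [B i = {x, y}],
    [B j = {x, z}]. The other pairs, all with [x] in [A p], are split by whether [B p] contains [w]
    or else both [y] and [z]. *)
Lemma forked_twin_half J A B i j x y z w : cross J A B ->
  forked J B A i j x y z w -> forked J A B i j w z y x ->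
  (forall p, p \in J -> (2 <= #|A p|)%N /\ (2 <= #|B p|)%N) ->
  (forall p, p \in J -> p != i -> p != j -> x \in A p) -> fsum J A B <= 5 / 6.
Proof.
move=> crs G F sz xA.
have crsS := cross_sym crs.
have [xy xz yz [wx wy wz]] := forked_dist crsS G.
have [iJ jJ ij _ _ _ _ _ _] := F.
pose R := J :\ i :\ j.
have RP p : p \in R -> [/\ p \in J, p != i & p != j] by rewrite !inE => /and3P[].
have -> : fsum J A B = wt #|A i| #|B i| + (wt #|A j| #|B j| + fsum R A B).
  by do 2![rewrite -fsumD1 ?inE ?iJ ?jJ 1?eq_sym ?ij //].
have sub (q : pred I) : [set p in R | q p] \subset J.
  by apply/subsetP => p /setIdP[/RP[]].
have crs1 : cross [set p in R | w \in B p] A B := cross_sub (sub _) crs.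
have crs2 : cross [set p in R | w \notin B p] A B := cross_sub (sub _) crs.
rewrite (fsumID (fun p => w \in B p) R).
have S1 p : p \in R -> [set x] \subset A p.
  by case/RP=> pJ pi pj; rewrite sub1set xA.
have T2 p : p \in [set p in R | w \notin B p] -> [set y; z] \subset B p.
  case/setIdP=> /RP[pJ pi pj] wB; apply/subsetP => v /set2P[] ->;
  by rewrite (forkedE crs F).
have wi : wt #|A i| #|B i| <= 6^-1 by apply: wt_le22; case: (sz i iJ).
have wj : wt #|A j| #|B j| <= 6^-1 by apply: wt_le22; case: (sz j jJ).
have P1 : fsum [set p in R | w \in B p] A B <= 1%:R / 3%:R.
  apply: (fsum_ratio (S := [set x]) (T := [set w]) crs1) => p /setIdP[pR wB].
  - exact: S1.
  - by rewrite sub1set.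
  by rewrite !cards1; have [pJ _ _] := RP p pR; have [] := sz p pJ; apply: wt_ratio11.
have P2 : fsum [set p in R | w \notin B p] A B <= 1%:R / 5%:R.
  apply: (fsum_ratio (S := [set x]) (T := [set y; z]) crs2) => p pR2.
  - by case/setIdP: pR2 => /S1.
  - exact: T2.
  rewrite cards1 cards2 yz; case/setIdP: pR2 => /RP[pJ _ _] _.
  by have [] := sz p pJ; apply: wt_ratio12.
(* 1/3 + 1/3 + 1/5 exceeds 5/6 by 1/30: either the 1/3 of the first family improves to 3/10,
   or a pair of sizes (2,2) in it prescribes a third element [s] of the sets [B p] in the
   second one. *)
case: (boolP [exists q in [set p in R | w \in B p], (#|A q| + #|B q| <= 4)%N]); last first.
  move/exists_inPn => big.
  have : fsum [set p in R | w \in B p] A B <= 3%:R / 10%:R.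
    apply: (fsum_ratio (S := [set x]) (T := [set w]) crs1) => p pR1.
    - by case/setIdP: pR1 => /S1.
    - by case/setIdP: pR1 => _; rewrite sub1set.
    rewrite !cards1; have := big p pR1; rewrite -ltnNge.
    case/setIdP: pR1 => /RP[pJ _ _] _.
    by have [] := sz p pJ; apply: wt_ratio11_strict.
  lra.
move=> /exists_inP[q /setIdP[qR wBq] q4]; have [qJ qi qj] := RP q qR.
have Aq2 : #|A q| = 2%N.
  have [a2 b2] := sz q qJ; apply/eqP; rewrite eqn_leq a2 andbT -(leq_add2r 2).
  by apply: leq_trans q4; rewrite leq_add2l.
have [s sA sx] : exists2 s, s \in A q & s != x.
  have /card_gt1P[s [t [sA tA st]]] : (1 < #|A q|)%N by rewrite Aq2.
  by case: (eqVneq s x) st => [->|sx _]; [rewrite eq_sym; exists t|exists s].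
have Aq : A q = [set x; s] by apply: set2_eq; rewrite // 1?eq_sym // xA.
have T3 p : p \in [set p in R | w \notin B p] -> [set y; z; s] \subset B p.
  move=> pR2; apply/subsetP => v; rewrite in_setU => /orP[/(subsetP (T2 p pR2))//|/set1P->].
  case/setIdP: pR2 => /RP[pJ pi pj] wB.
  have qp : q != p by apply: contraNneq wB => <-.
  rewrite (pair_xor crs qJ pJ qp Aq) 1?eq_sym //.
  by apply/negP; apply: cross_disjoint crs pJ (xA p pJ pi pj).
(* [s] is new: [x] is in [A q], so the dual fork excludes [y] and [z] from [A q]. *)
have c3 : #|[set y; z; s]| = 3%N.
  rewrite setUC cardsU1 cards2 yz !inE negb_or.
  have [ya za] : y \notin A q /\ z \notin A q.
    by split; rewrite (forkedE crsS G) ?negbK ?xA.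
  by rewrite (contraNneq _ ya) ?(contraNneq _ za) // => <-.
have : fsum [set p in R | w \notin B p] A B <= 1%:R / 6%:R.
  apply: (fsum_ratio (S := [set x]) (T := [set y; z; s]) crs2) => p pR2.
  - by case/setIdP: pR2 => /S1.
  - exact: T3.
  rewrite cards1 c3; have := subset_leq_card (T3 p pR2); rewrite c3 => b3.
  case/setIdP: pR2 => /RP[pJ _ _] _.
  by have [a2 _] := sz p pJ; apply: wt_ratio13.
lra.
Qed.

(** Either [x] is in all other [A p], or [w] is in all other [B p], which is the dual situation.
    Otherwise some [A q] and some [B p] would both contain [y] and [z], and so meet twice. *)
Lemma forked_twin J A B i j x y z w : cross J A B ->
  forked J B A i j x y z w -> #|A i| = 2%N -> #|A j| = 2%N ->
  (forall p, p \in J -> (2 <= #|A p|)%N /\ (2 <= #|B p|)%N) -> fsum J A B <= 5 / 6.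
Proof.
move=> crs G Ai2 Aj2 sz; have crsS := cross_sym crs.
have [xy xz yz [wx wy wz]] := forked_dist crsS G.
have [iJ jJ ij Bi Bj zAi wAi yAj wAj] := G.
have F : forked J A B i j w z y x.
  split=> //; rewrite ?Bi ?Bj ?inE ?eqxx ?orbT //; first exact: set2_eq.
  exact: set2_eq.
case: (boolP [forall p in J, [|| p == i, p == j | x \in A p]]) => [/forall_inP xA|].
  apply: (forked_twin_half crs G F sz) => p pJ pi pj.
  by have := xA p pJ; rewrite (negbTE pi) (negbTE pj).
rewrite negb_forall_in => /exists_inP[q qJ]; rewrite !negb_or => /and3P[qi qj xq].
rewrite fsum_sym; apply: (forked_twin_half crsS F G) => [p pJ|p pJ pi pj].
  by have [] := sz p pJ.
apply: contraT => wB.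
have [yA zA] : y \in A q /\ z \in A q by split; rewrite (forkedE crsS G).
have [yB zB] : y \in B p /\ z \in B p by split; rewrite (forkedE crs F).
have qp : q != p.
  by apply/negP => /eqP E; apply: (cross_disjoint crs pJ) yB; rewrite -E.
by rewrite (cross_inj crs qJ pJ qp yA yB zA zB) eqxx in yz.
Qed.

(** The three pairs at [i], [j], [l] weigh at most 1/2 in total, leaving 1/3. This is what
    [wt_ratio11] gives for the rest, once one element is prescribed on each side. *)
Lemma forked_shared J A B i j x y z w l : cross J A B ->
  forked J B A i j x y z w -> #|A i| = 2%N -> l \in J -> l != i -> l != j ->
  #|A l| = 2%N -> A l :&: A i != set0 -> B l :&: B i != set0 ->
  (forall p, p \in J -> (2 <= #|A p|)%N /\ (2 <= #|B p|)%N) -> fsum J A B <= 5 / 6.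
Proof.
move=> crs G Ai2 lJ li lj Al2 /set0Pn[a /setIP[al ai]] /set0Pn[b /setIP[bl bi]] sz.
have crsS := cross_sym crs.
have [xy xz yz [wx wy wz]] := forked_dist crsS G.
have [iJ jJ ij Bi Bj zAi wAi yAj wAj] := G.
have Ai : A i = [set z; w] by apply: set2_eq; rewrite // eq_sym.
pose R := J :\ i :\ j :\ l.
have RP p : p \in R -> [/\ p \in J, p != i, p != j & p != l].
  by rewrite !inE => /and4P[].
have -> : fsum J A B =
    wt #|A i| #|B i| + (wt #|A j| #|B j| + (wt #|A l| #|B l| + fsum R A B)).
  by do 3![rewrite -fsumD1 ?inE ?iJ ?jJ ?lJ ?li ?lj 1?eq_sym ?ij //].
have wt6 p : p \in J -> wt #|A p| #|B p| <= 6^-1.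
  by case/sz; apply: wt_le22.
have := (wt6 i iJ, wt6 j jJ, wt6 l lJ) => -[[]].
suff [t tP] : exists t, forall p, p \in R -> x \in A p /\ t \in B p.
  suff : fsum R A B <= 1%:R / 3%:R by lra.
  have crsR : cross R A B by apply: cross_sub crs; apply/subsetP => p /RP[].
  apply: (fsum_ratio (S := [set x]) (T := [set t]) crsR) => p pR.
  - by rewrite sub1set; case: (tP p pR).
  - by rewrite sub1set; case: (tP p pR).
  by rewrite !cards1; have [pJ _ _ _] := RP p pR; have [] := sz p pJ; apply: wt_ratio11.
have F p : p \in J -> p != i -> (w \in B p) = (z \notin B p).
  by move=> pJ pi; apply: pair_xor crs iJ pJ _ Ai _; rewrite eq_sym.
have NB p v : p \in J -> v \in A p -> v \notin B p.
  by move=> pJ vA; apply/negP; apply: cross_disjoint crs pJ vA.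
(* If [x] is in [A l], then [A l = {x, w}] while [B l] contains [y] and [z], and the prescribed
   elements are [x] and [w]. Otherwise [A l = {y, z}], and they are [x] and [z]. *)
case: (boolP (x \in A l)) => xl.
  have [yl zl] : y \notin A l /\ z \notin A l by split; rewrite (forkedE crsS G) ?xl.
  have wl : w \in A l by move: ai al; rewrite Ai => /set2P[] -> //; rewrite (negbTE zl).
  have Al : A l = [set x; w] by apply: set2_eq; rewrite // eq_sym.
  have yB : y \in B l by move: bi bl; rewrite Bi => /set2P[] -> //; rewrite (negbTE (NB l x lJ xl)).
  have zB : z \in B l by apply: contraT; rewrite -F // (negbTE (NB l w lJ wl)).
  exists w => p /RP[pJ pi pj pl].
  have xp : x \in A p.
    apply: contraT => xp.
    have [yA zA] : y \in A p /\ z \in A p by split; rewrite (forkedE crsS G).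
    by rewrite (cross_inj crs pJ lJ pl yA yB zA zB) eqxx in yz.
  split=> //; rewrite (pair_xor crs lJ pJ _ Al) 1?eq_sym //; exact: NB.
have [yl zl] : y \in A l /\ z \in A l by split; rewrite (forkedE crsS G).
have Al : A l = [set y; z] by apply: set2_eq.
have wl : w \in B l by rewrite F // NB.
exists z => p /RP[pJ pi pj pl].
have zB : z \in B p.
  apply: contraT => zp.
  have wB : w \in B p by rewrite F.
  have yB : y \in B p.
    by apply: contraT; rewrite -(pair_xor crs lJ pJ _ Al) // 1?eq_sym // (negbTE zp).
  have jp : j != p by rewrite eq_sym.
  by rewrite (cross_inj crs jJ pJ jp yAj yB wAj wB) eqxx in wy.
split=> //; apply: contraT => xp; have zA : z \in A p by rewrite (forkedE crsS G).
by have := NB _ _ pJ zA; rewrite zB.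
Qed.

(** * Opposite forks with a common centre *)

(** One use of Bollobas' inequality on [Q], after deleting [S] on the left and [y], [z] on the
    right, pays for both sums. Where [x] is missing from [A p], deleting [S] can only increase the
    weight. *)
Lemma fork_side_sum c J A B k l x y z w (Q : {set I}) S : cross J A B ->
  forked J A B k l x y z w ->
  (forall p, (p \in Q) = [&& p \in J, p != k, p != l & x \notin B p]) -> 0 <= c ->
  (forall p v, p \in Q -> v \in S -> v \notin B p) ->
  (forall p, p \in Q -> x \in A p ->
     wt #|A p| #|B p| <= c * wt #|A p :\: S| (#|B p| - 2)) ->
  \sum_(p in Q | x \in A p) wt #|A p| #|B p| +
    c * \sum_(p in Q | x \notin A p) wt #|A p| (#|B p| - 2) <= c.
Proof.
move=> crs F QE c0 SB le; have [xy xz yz _] := forked_dist crs F.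
have QT p v : p \in Q -> v \in [set y; z] -> v \in B p.
  by rewrite QE => /and4P[pJ pk pl xB] /set2P[] ->; rewrite (forkedE crs F).
have QJ : Q \subset J by apply/subsetP => p; rewrite QE => /andP[].
have crsQ := cross_sub QJ crs.
have TA p v : p \in Q -> v \in [set y; z] -> v \notin A p.
  by move=> pQ vT; apply/negP => vA; apply: (cross_disjoint crsQ pQ vA); apply: QT.
have := fsum_setD_le1 crsQ SB TA.
have BT p : p \in Q -> #|B p :\: [set y; z]| = (#|B p| - 2)%N.
  move=> pQ; rewrite cardsD (setIidPr _) ?cards2 ?yz //.
  by apply/subsetP => v; apply: QT.
move=> /(ler_wpM2l c0); rewrite mulr1; apply: le_trans.
rewrite [in leRHS](bigID (fun p => x \in A p)) /= mulrDr; apply: lerD.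
  rewrite mulr_sumr; apply: ler_sum => p /andP[pQ xA]; rewrite BT //; exact: le.
apply: ler_wpM2l => //; apply: ler_sum => p /andP[pQ _]; rewrite BT //.
by apply: wt_anti => //; apply: subset_leq_card; apply: subsetDl.
Qed.

(** The one configuration in which deleting two elements on each side gains no more than the factor
    1/6. The bound 4/15 is [1/6 + 1/10]. *)
Definition side_extreme J A B k l x y z w (Q : {set I}) : Prop :=
  exists p, [/\ Q = [set p], A p = [set x; w], B p = [set y; z] &
    wt #|A k| #|B k| + wt #|A l| #|B l| <= 4 / 15].

(* In [forked_cross] the pairs avoiding [x] on both sides belong to the family [Q] of either
   fork; [wt_split_le] lets each fork pay for its share of them, which is why the second sum
   carries the weights [wt a (b - 2)]. *)
Definition side_regular J A B k l x (Q : {set I}) : Prop :=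
  exists c, [/\ 1 / 8 <= c, wt #|A k| #|B k| + wt #|A l| #|B l| + c <= 2 / 5 &
    \sum_(p in Q | x \in A p) wt #|A p| #|B p| +
      c * \sum_(p in Q | x \notin A p) wt #|A p| (#|B p| - 2) <= c].

(** As [B k] has two elements, [w] is in [A p] for all [p] in [Q]. When [x] is there too, two
    elements are prescribed on each side, with ratio at most 1/10 unless both sizes are 2. *)
Lemma fork_side_half J A B k l x y z w (Q : {set I}) : cross J A B ->
  forked J A B k l x y z w ->
  (forall p, p \in J -> (2 <= #|A p|)%N /\ (2 <= #|B p|)%N) ->
  (forall p, (p \in Q) = [&& p \in J, p != k, p != l & x \notin B p]) ->
  #|B k| = 2%N -> (3 <= #|B l|)%N ->
  side_extreme J A B k l x y z w Q \/ side_regular J A B k l x Q.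
Proof.
move=> crs F sz QE Bk2 Bl3.
have [xy xz yz [wx wy wz]] := forked_dist crs F.
have [kJ lJ kl Ak Al zBk wBk yBl wBl] := F.
have [ak bk] := sz k kJ; have [al _] := sz l lJ.
have wtk := wt_le22 ak bk; have wtl := wt_le23 al Bl3.
have wA p : p \in Q -> w \in A p.
  by rewrite QE => /and4P[pJ pk pl xB]; apply: (forked_B2 crs F).
have QB p : p \in Q -> [set y; z] \subset B p.
  rewrite QE => /and4P[pJ pk pl xB].
  by apply/subsetP => v /set2P[] ->; rewrite (forkedE crs F).
have QJ p : p \in Q -> p \in J by rewrite QE => /andP[].
have cS : #|[set x; w]| = 2%N by rewrite cards2 eq_sym wx.
have cT : #|[set y; z]| = 2%N by rewrite cards2 yz.
have QA p : p \in Q -> x \in A p -> [set x; w] \subset A p.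
  by move=> pQ xA; apply/subsetP => v /set2P[] ->; rewrite ?wA.
case: (boolP [exists p in Q, (x \in A p) && (#|A p| + #|B p| <= 4)%N]).
  move=> /exists_inP[p pQ /andP[xA p4]]; left; exists p.
  have [a2 b2] := sz p (QJ p pQ).
  have Ap2 : #|A p| = 2%N.
    apply/eqP; rewrite eqn_leq a2 andbT -(leq_add2r 2).
    by apply: leq_trans p4; rewrite leq_add2l.
  have Bp2 : #|B p| = 2%N.
    apply/eqP; rewrite eqn_leq b2 andbT -(leq_add2l 2).
    by apply: leq_trans p4; rewrite leq_add2r.
  have Ap : A p = [set x; w] by apply/esym/eqP; rewrite eqEcard QA // cS Ap2.
  have Bp : B p = [set y; z] by apply/esym/eqP; rewrite eqEcard QB // cT Bp2.
  split; [|exact: Ap|exact: Bp|lra].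
  (* Another [q] in [Q] would have [B p] inside [B q], so [A q], which meets [B p], would meet
     [B q]. *)
  apply/setP => q; rewrite inE; apply/idP/eqP => [qQ|-> //].
  apply/eqP; apply: contraT => qp.
  have [t] := cross_meet crs (QJ q qQ) (QJ p pQ) qp.
  rewrite Bp => tA /(subsetP (QB q qQ)) tB.
  by case: (cross_disjoint crs (QJ q qQ) tA tB).
(* The value 2/15 is what [1/6 + 1/10] leaves of 2/5; it exceeds both 1/10 and the required 1/8. *)
move/exists_inPn => big; right; exists (2 / 15); split; [lra|lra|].
apply: (fork_side_sum (S := [set x; w]) crs F QE); first lra.
  move=> p v pQ; have := pQ; rewrite QE => /and4P[pJ pk pl xB] /set2P[] -> //.
  by apply/negP; apply: cross_disjoint crs pJ (wA p pQ).
move=> p pQ xA; have [a2 b2] := sz p (QJ p pQ).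
rewrite cardsD (setIidPr (QA p pQ xA)) cS.
have := big p pQ; rewrite xA -ltnNge => p5.
apply: le_trans (wt_ratio22_strict a2 b2 p5) _.
by apply: ler_wpM2r; [exact: wt_ge0|lra].
Qed.

Lemma fork_side J A B k l x y z w (Q : {set I}) : cross J A B ->
  forked J A B k l x y z w ->
  (forall p, p \in J -> (2 <= #|A p|)%N /\ (2 <= #|B p|)%N) ->
  (forall p, (p \in Q) = [&& p \in J, p != k, p != l & x \notin B p]) ->
  [\/ #|B k| = 2%N /\ #|B l| = 2%N, side_extreme J A B k l x y z w Q
    | side_regular J A B k l x Q].
Proof.
move=> crs F sz QE; have [kJ lJ _ _ _ _ _ _ _] := F.
have [ak bk] := sz k kJ; have [al bl] := sz l lJ.
case: (ltnP 2 #|B k|) => Bk3; case: (ltnP 2 #|B l|) => Bl3.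
- apply: Or33; exists (1 / 5).
  have := wt_le23 ak Bk3; have := wt_le23 al Bl3 => wtl wtk.
  split; [lra|lra|].
  apply: (fork_side_sum (S := [set x]) crs F QE); first lra.
    by move=> p v; rewrite QE => /and4P[pJ pk pl xB] /set1P ->.
  move=> p; rewrite QE => /and4P[pJ _ _ _] xA; have [a2 b2] := sz p pJ.
  have /setIidPr sub : [set x] \subset A p by rewrite sub1set.
  by rewrite cardsD sub cards1; apply: wt_ratio12.
- have QE' p : (p \in Q) = [&& p \in J, p != l, p != k & x \notin B p].
    by rewrite QE; case: (p != k); case: (p != l).
  have Bl2 : #|B l| = 2%N by apply/eqP; rewrite eqn_leq Bl3.
  have [[p [Qp Ap Bp le]]|[c [c8 le sum]]] :=
    fork_side_half crs (forked_sym F) sz QE' Bl2 Bk3.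
    apply: Or32; exists p; split; [exact: Qp|exact: Ap|by rewrite Bp setUC|by rewrite addrC].
  apply: Or33; exists c; split; [exact: c8| |exact: sum].
  by rewrite [wt _ _ + wt _ _]addrC.
- have Bk2 : #|B k| = 2%N by apply/eqP; rewrite eqn_leq Bk3.
  by case: (fork_side_half crs F sz QE Bk2 Bl3) => h; [apply: Or32|apply: Or33].
by apply: Or31; split; apply/eqP; rewrite eqn_leq ?Bk3 ?Bl3.
Qed.

(** The common centre [x] makes [i], [j], [k], [l] distinct. The remaining pairs have [x] in [A p]
    ([X1]), in [B p] ([X2]) or in neither ([X3]). Two regular forks cost 2/5 each, and an extreme
    one [4/15 + 1/6] with [X3 = 0], so a single extreme fork gives exactly 5/6. *)
Lemma forked_cross J A B i j k l x y z w y' z' w' : cross J A B ->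
  forked J A B k l x y z w -> forked J B A i j x y' z' w' ->
  (forall p, p \in J -> (2 <= #|A p|)%N /\ (2 <= #|B p|)%N) -> fsum J A B <= 5 / 6.
Proof.
move=> crs F G sz; have crsS := cross_sym crs.
have [kJ lJ kl Ak Al _ _ _ _] := F; have [iJ jJ ij Bi Bj _ _ _ _] := G.
have NB p v : p \in J -> v \in A p -> v \notin B p.
  by move=> pJ vA; apply/negP; apply: cross_disjoint crs pJ vA.
have [xk xl] : x \in A k /\ x \in A l by rewrite Ak Al !inE eqxx.
have [xi xj] : x \in B i /\ x \in B j by rewrite Bi Bj !inE eqxx.
have ki : k != i by apply: contraTneq xk => ->; apply: contraL xi; apply: NB.
have kj : k != j by apply: contraTneq xk => ->; apply: contraL xj; apply: NB.
have li : l != i by apply: contraTneq xl => ->; apply: contraL xi; apply: NB.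
have lj : l != j by apply: contraTneq xl => ->; apply: contraL xj; apply: NB.
pose R := J :\ i :\ j :\ k :\ l.
have RE p : (p \in R) = [&& p \in J, p != i, p != j, p != k & p != l].
  rewrite !inE; case: (p \in J); case: (p == i); case: (p == j);
    by case: (p == k); case: (p == l).
pose QF := [set p in J | [&& p != k, p != l & x \notin B p]].
pose QG := [set p in J | [&& p != i, p != j & x \notin A p]].
have QFE p : (p \in QF) = [&& p \in J, p != k, p != l & x \notin B p] by rewrite inE.
have QGE p : (p \in QG) = [&& p \in J, p != i, p != j & x \notin A p] by rewrite inE.
have nij p : x \notin B p -> (p != i) && (p != j).
  by move=> xp; apply/andP; split; apply: contraNneq xp => ->.
have nkl p : x \notin A p -> (p != k) && (p != l).
  by move=> xp; apply/andP; split; apply: contraNneq xp => ->.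
have QFA p : (p \in QF) && (x \in A p) = (p \in R) && (x \in A p).
  rewrite QFE RE; case pJ: (p \in J) => //=; case: (boolP (x \in A p)) => xA.
    by have xB := NB p x pJ xA; case/andP: (nij p xB) => -> ->; rewrite xB !andbT.
  by rewrite !andbF.
have QGB p : (p \in QG) && (x \in B p) = (p \in R) && (x \notin A p) && (x \in B p).
  rewrite QGE RE; case pJ: (p \in J) => //=; case: (boolP (x \in A p)) => xA.
    by rewrite !andbF.
  by case/andP: (nkl p xA) => -> ->; rewrite !andbT.
have QFN p : (p \in QF) && (x \notin A p) = (p \in R) && (x \notin A p) && (x \notin B p).
  rewrite QFE RE; case pJ: (p \in J) => //=; case: (boolP (x \in B p)) => xB.
    by rewrite !andbF.
  by case/andP: (nij p xB) => -> ->; rewrite !andbT.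
have QGN p : (p \in QG) && (x \notin B p) = (p \in R) && (x \notin A p) && (x \notin B p).
  rewrite QGE RE; case pJ: (p \in J) => //=; case: (boolP (x \in A p)) => xA.
    by rewrite !andbF.
  by case/andP: (nkl p xA) => -> ->; rewrite !andbT.
pose X1 := \sum_(p in QF | x \in A p) wt #|A p| #|B p|.
pose X2 := \sum_(p in QG | x \in B p) wt #|B p| #|A p|.
pose X3 := \sum_(p in QF | x \notin A p) wt #|A p| #|B p|.
pose Y1 := \sum_(p in QF | x \notin A p) wt #|A p| (#|B p| - 2).
pose Y2 := \sum_(p in QG | x \notin B p) wt #|B p| (#|A p| - 2).
have total : fsum J A B = wt #|B i| #|A i| + wt #|B j| #|A j| +
    (wt #|A k| #|B k| + wt #|A l| #|B l|) + (X1 + X2 + X3).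
  have -> : X1 + X2 + X3 = fsum R A B.
    rewrite /fsum (bigID (fun p => x \in A p)) /= -addrA; congr (_ + _).
      by apply: eq_bigl => p; rewrite QFA.
    rewrite (bigID (fun p => x \in B p)) /=; congr (_ + _).
      by apply: eq_big => [p|p _]; rewrite ?QGB // wtC.
    by apply: eq_bigl => p; rewrite QFN.
  rewrite (wtC #|B i|) (wtC #|B j|) -!addrA.
  by do 4![rewrite -fsumD1 ?inE ?iJ ?jJ ?kJ ?lJ ?ki ?kj ?li ?lj 1?eq_sym ?ij ?kl //].
have X3le : 8 * X3 <= Y1 + Y2.
  rewrite /X3 /Y1 /Y2 mulr_sumr (eq_bigl _ _ QGN) -(eq_bigl _ _ QFN) -big_split /=.
  apply: ler_sum => p /andP[]; rewrite QFE => /andP[pJ _] _; have [a2 b2] := sz p pJ.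
  by rewrite (wtC #|B p|) addrC; apply: wt_split_le.
have Y1ge : 0 <= Y1 by apply: sumr_ge0 => p _; apply: wt_ge0.
have Y2ge : 0 <= Y2 by apply: sumr_ge0 => p _; apply: wt_ge0.
have szS p : p \in J -> (2 <= #|B p|)%N /\ (2 <= #|A p|)%N by case/sz.
have regB (c Y : rat) : 1 / 8 <= c -> 0 <= Y -> Y / 8 <= c * Y.
  by move=> c8 Y0; rewrite mulrC; apply: ler_wpM2r.
have extF : side_extreme J A B k l x y z w QF -> [/\ X1 <= 6^-1, X3 = 0 &
    wt #|A k| #|B k| + wt #|A l| #|B l| <= 4 / 15].
  move=> [p [Qp Ap Bp le]]; have xA : x \in A p by rewrite Ap !inE eqxx.
  have pJ : p \in J by have := set11 p; rewrite -Qp QFE => /andP[].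
  have [a2 b2] := sz p pJ; split; [|rewrite /X3|exact: le].
    by rewrite /X1 Qp big_mkcondr big_set1 xA; apply: wt_le22.
  by rewrite Qp big_mkcondr big_set1 xA.
have extG : side_extreme J B A i j x y' z' w' QG -> [/\ X2 <= 6^-1, X3 = 0 &
    wt #|B i| #|A i| + wt #|B j| #|A j| <= 4 / 15].
  move=> [p [Qp Bp Ap le]]; have xB : x \in B p by rewrite Bp !inE eqxx.
  have pJ : p \in J by have := set11 p; rewrite -Qp QGE => /andP[].
  have [a2 b2] := sz p pJ; split; [|rewrite /X3|exact: le].
    by rewrite /X2 Qp big_mkcondr big_set1 xB; apply: wt_le22.
  rewrite (eq_bigl (fun q => (q \in QG) && (x \notin B q))) => [|q]; last by rewrite QFN QGN.
  by rewrite Qp big_mkcondr big_set1 xB.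
(* With both forks extreme, [A q] and [B p] share a point [t] other than [x]. Then [{x, t}] is [A k]
   or [A l], and also [B i] or [B j], so two sets that should cross once would share two points. *)
have noext : side_extreme J A B k l x y z w QF -> side_extreme J B A i j x y' z' w' QG -> False.
  move=> [p [Qp Ap Bp _]] [q [Qq Bq Aq _]].
  have pJ : p \in J by have := set11 p; rewrite -Qp QFE => /andP[].
  have qJ : q \in J by have := set11 q; rewrite -Qq QGE => /andP[].
  have qp : q != p.
    apply/eqP => E; have := NB p x pJ; rewrite -{2}E Ap Bq !inE eqxx => /(_ isT).
    by [].
  have [t] := cross_meet crs qJ pJ qp; rewrite Aq Bp => tA tB.
  have [xy xz _ _] := forked_dist crs F.
  have [u [uJ ui uj [xu tu tx]]] : exists u, [/\ u \in J, u != i, u != j &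
      [/\ x \in A u, t \in A u & x != t]].
    by case/set2P: tB => ->; [exists k|exists l]; split=> //; split=> //;
      rewrite ?Ak ?Al !inE eqxx orbT.
  suff [v [vJ uv xv tv]] : exists v, [/\ v \in J, u != v, x \in B v & t \in B v].
    by rewrite (cross_inj crs uJ vJ uv xu xv tu tv) eqxx in tx.
  by case/set2P: tA => ->; [exists i|exists j]; split=> //; rewrite ?Bi ?Bj !inE eqxx orbT.
rewrite total; move: X3le Y1ge Y2ge extF extG.
have [[Bk2 Bl2]|eF|[c [c8 le sumF]]] := fork_side crs F sz QFE.
- by move=> _ _ _ _ _; rewrite -total fsum_sym; apply: (forked_twin crsS F).
- have [[Ai2 Aj2]|eG|[d [d8 leG sumG]]] := fork_side crsS G szS QGE.
  + by move=> _ _ _ _ _; rewrite -total; apply: (forked_twin crs G).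
  + by case: (noext eF eG).
  move=> _ _ Y2ge /(_ eF)[X1le -> leF] _; have dY := regB _ _ d8 Y2ge.
  move: sumG dY; rewrite -/X2 -/Y2; move: (d * Y2) => dY; lra.
have [[Ai2 Aj2]|eG|[d [d8 leG sumG]]] := fork_side crsS G szS QGE.
- by move=> _ _ _ _ _; rewrite -total; apply: (forked_twin crs G).
- move=> _ Y1ge _ _ /(_ eG)[X2le -> leG]; have cY := regB _ _ c8 Y1ge.
  move: sumF cY; rewrite -/X1 -/Y1; move: (c * Y1) => cY; lra.
(* As [c] and [d] are at least 1/8, [X3] is at most [c * Y1 + d * Y2], which the two fork budgets
   already cover. *)
move=> X3le Y1ge Y2ge _ _; have cY := regB _ _ c8 Y1ge; have dY := regB _ _ d8 Y2ge.
move: sumF sumG cY dY; rewrite -/X1 -/Y1 -/X2 -/Y2.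
move: (c * Y1) (d * Y2) => cY dY; lra.
Qed.

(** Forks sharing an index are settled by [forked_twin] or [forked_shared]; forks on four distinct
    indices turn out to have the same centre. *)
Lemma two_forks J A B i j k l x y z w x' y' z' w' : cross J A B ->
  forked J A B k l x y z w -> forked J B A i j x' y' z' w' ->
  (forall p, p \in J -> (2 <= #|A p|)%N /\ (2 <= #|B p|)%N) -> fsum J A B <= 5 / 6.
Proof.
move=> crs F G sz; have crsS := cross_sym crs.
have [xy xz yz _] := forked_dist crs F; have [xy' xz' yz' _] := forked_dist crsS G.
have [kJ lJ kl Ak Al zBk wBk yBl wBl] := F.
have Ak2 : #|A k| = 2%N by rewrite Ak cards2 xy.
have Al2 : #|A l| = 2%N by rewrite Al cards2 xz.
have [xk xl] : x \in A k /\ x \in A l by rewrite Ak Al !inE eqxx.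
have Akl : A k :&: A l != set0 by apply/set0Pn; exists x; rewrite inE xk.
have Bkl : B k :&: B l != set0 by apply/set0Pn; exists w; rewrite inE wBk.
have Alk : A l :&: A k != set0 by rewrite setIC.
have Blk : B l :&: B k != set0 by rewrite setIC.
have [ki|ki] := eqVneq k i.
  have [lj|lj] := eqVneq l j; first by apply: (forked_twin crs G); rewrite -?ki -?lj.
  by apply: (forked_shared crs G _ lJ); rewrite -?ki // eq_sym.
have [kj|kj] := eqVneq k j.
  have [li|li] := eqVneq l i; first by apply: (forked_twin crs G); rewrite -?kj -?li.
  by apply: (forked_shared crs (forked_sym G) _ lJ); rewrite -?kj // eq_sym.
have [li|li] := eqVneq l i.
  by apply: (forked_shared crs G _ kJ); rewrite -?li.
have [lj|lj] := eqVneq l j.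
  by apply: (forked_shared crs (forked_sym G) _ kJ); rewrite -?lj.
have NA p v : p \in J -> v \in B p -> v \notin A p.
  by move=> pJ vB; apply/negP => vA; apply: cross_disjoint crs pJ vA vB.
(* If [x'] is not in [A u], then [A u = {y', z'}]. Then [x], also in [A v], is one of these two, so
   the dual fork puts both into [A v], against the choice of [t]. Applied to [k] and [l], this puts
   [x'] in [A k] and [A l], which share only [x]. *)
have key u v t : u \in J -> u != i -> u != j -> v \in J -> v != i -> v != j ->
    #|A u| = 2%N -> x \in A u -> x \in A v -> t \in A u -> t \notin A v -> x' \in A u.
  move=> uJ ui uj vJ vi vj Au2 xu xv tu; apply: contraR => x'u.
  have [y'u z'u] : y' \in A u /\ z' \in A u by split; rewrite (forkedE crsS G).
  have E : A u = [set y'; z'] by apply: set2_eq.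
  have x'v : x' \notin A v.
    by move: xu; rewrite E => /set2P[] X; move: xv; rewrite X (forkedE crsS G).
  by move: tu; rewrite E => /set2P[] ->; rewrite (forkedE crsS G).
have x'k := key k l y kJ ki kj lJ li lj Ak2 xk xl.
have x'l := key l k z lJ li lj kJ ki kj Al2 xl xk.
have X : x' = x.
  have : x' \in A k by apply: x'k; [rewrite Ak !inE eqxx orbT|exact: NA].
  rewrite Ak => /set2P[] // E; have /negP[] := NA l y lJ yBl; rewrite -E.
  by apply: x'l; [rewrite Al !inE eqxx orbT|exact: NA].
by move: G; rewrite X => G'; apply: (forked_cross crs F G').
Qed.

(** * Exceptional links and the induction *)

Definition has_fork J A B : bool :=
  [exists k in J, exists l in J, [&& k != l, #|A k| == 2%N, #|A l| == 2%N,
    A k :&: A l != set0 & B k :&: B l != set0]].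

Lemma has_forkP J A B : cross J A B -> has_fork J A B ->
  exists k l x y z w, forked J A B k l x y z w.
Proof.
move=> crs /exists_inP[k kJ /exists_inP[l lJ]].
move=> /and5P[kl /eqP Ak2 /eqP Al2 /set0Pn[x /setIP[xk xl]] /set0Pn[w /setIP[wk wl]]].
have [y yA yB] := cross_meet crs kJ lJ kl.
have [|z zA zB] := cross_meet crs lJ kJ; first by rewrite eq_sym.
exists k, l, x, y, z, w; split=> //; apply: set2_eq => //.
  by apply/eqP => E; apply: cross_disjoint crs lJ xl _; rewrite E.
by apply/eqP => E; apply: cross_disjoint crs kJ xk _; rewrite E.
Qed.

Definition admissible J A B : Prop := forall i j, i \in J -> j \in J -> i != j ->
  [/\ ~ [/\ #|A i| = 1%N, #|A j| = 1%N & B i :&: B j != set0],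
      ~ [/\ #|B i| = 1%N, #|B j| = 1%N & A i :&: A j != set0] &
      ~ [/\ #|A i| = 1%N, #|A j| = 1%N, #|B i| = 1%N & #|B j| = 1%N]].

Lemma admissible_sym J A B : admissible J A B -> admissible J B A.
Proof.
move=> adm i j iJ jJ ij; have [a b c] := adm i j iJ jJ ij; split=> //.
by case=> *; apply: c.
Qed.

(** An [A i] becomes a singleton in the link only if it has two elements, one being [u]. Two such
    sets with meeting [B]'s form a fork; with singleton [B]'s they are already excluded in the
    original system, since both contain [u]. Links with at most one pair weigh at most 1/2. *)
Lemma link_step J A B : cross J A B -> (1 < #|J|)%N -> admissible J A B ->
  (forall i, i \in J -> (2 <= #|A i|)%N) -> ~~ has_fork J A B ->
  (forall J' A', (#|supp J' A' B| < #|supp J A B|)%N -> cross J' A' B ->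
     (1 < #|J'|)%N -> admissible J' A' B -> fsum J' A' B <= 5 / 6) ->
  fsum J A B <= 5 / 6.
Proof.
move=> crs J1 adm A2 nofork IH; apply: (fsum_le_link crs J1) => u uS.
have LJ i : i \in link u J B -> i \in J /\ u \notin B i by case/setIdP.
have B1 i : i \in J -> (1 <= #|B i|)%N.
  by move=> iJ; rewrite card_gt0; apply: (cross_neq0 (cross_sym crs)).
have A1 i : i \in J -> (1 <= #|A i :\ u|)%N.
  by move=> /A2; rewrite (cardsD1 u (A i)); case: (u \in A i) => // /ltnW.
case: (ltnP 1 #|link u J B|) => L1; last first.
  apply: (@le_trans _ _ 2^-1); last by lra.
  apply: fsum_small; rewrite ?invr_ge0 ?ler0n // => i /LJ[iJ _].
  by apply: wt_le11; [exact: A1|exact: B1].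
apply: IH => //; [exact: supp_link|exact: cross_link|].
have single i : i \in J -> #|A i :\ u| = 1%N -> u \in A i /\ #|A i| = 2%N.
  move=> iJ E; have := A2 i iJ; rewrite (cardsD1 u (A i)) E.
  by case: (u \in A i).
move=> i j /LJ[iJ ui] /LJ[jJ uj] ij; split.
- move=> [/(single i iJ)[uAi Ai2] /(single j jJ)[uAj Aj2] BB].
  move/negP: nofork; apply; apply/exists_inP; exists i => //; apply/exists_inP; exists j => //.
  by rewrite ij Ai2 Aj2 BB !eqxx /= andbT; apply/set0Pn; exists u; rewrite inE uAi.
- move=> [Bi Bj /set0Pn[v]]; rewrite !inE => /andP[/andP[_ vi] /andP[_ vj]].
  have [_ h _] := adm i j iJ jJ ij; apply: h; split=> //.
  by apply/set0Pn; exists v; rewrite inE vi.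
move=> [/(single i iJ)[uAi Ai2] /(single j jJ)[uAj Aj2] Bi Bj].
have [_ h _] := adm i j iJ jJ ij; apply: h; split=> //.
by apply/set0Pn; exists u; rewrite inE uAi.
Qed.

Lemma wt_le_third a b : (1 <= a)%N -> (1 <= b)%N -> ~ (a = 1%N /\ b = 1%N) -> wt a b <= 3^-1.
Proof.
move=> a1 b1 ab; case: (ltnP 1 a) => a2; first exact: wt_le21.
case: (ltnP 1 b) => b2; first by rewrite wtC; apply: wt_le21.
by case: ab; split; apply/eqP; rewrite eqn_leq ?a2 ?b2.
Qed.

(** Admissibility forbids two pairs of sizes (1, 1), so the weights are at most [1/2 + 1/3]. *)
Lemma fsum_pair J A B : cross J A B -> #|J| = 2%N -> admissible J A B -> fsum J A B <= 5 / 6.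
Proof.
move=> crs J2 adm; have J1 : (1 < #|J|)%N by rewrite J2.
have /eqP/cards2P[i [j [ij E]]] := J2.
have [iJ jJ] : i \in J /\ j \in J by rewrite E !inE !eqxx orbT.
have A1 p : p \in J -> (1 <= #|A p|)%N.
  by move=> pJ; rewrite card_gt0; apply: (cross_neq0 crs).
have B1 p : p \in J -> (1 <= #|B p|)%N.
  by move=> pJ; rewrite card_gt0; apply: (cross_neq0 (cross_sym crs)).
have -> : fsum J A B = wt #|A i| #|B i| + wt #|A j| #|B j|.
  by rewrite /fsum E big_setU1 ?inE //= big_set1.
have hi := wt_le11 (A1 i iJ) (B1 i iJ); have hj := wt_le11 (A1 j jJ) (B1 j jJ).
case: (boolP ((#|A i| == 1%N) && (#|B i| == 1%N))) => [/andP[/eqP Ai /eqP Bi]|ne].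
  have : wt #|A j| #|B j| <= 3^-1.
    apply: wt_le_third (A1 j jJ) (B1 j jJ) _ => -[Aj Bj].
    by have [_ _ []] := adm i j iJ jJ ij.
  lra.
have : wt #|A i| #|B i| <= 3^-1.
  apply: wt_le_third (A1 i iJ) (B1 i iJ) _ => -[Ai Bi].
  by rewrite Ai Bi in ne.
lra.
Qed.

(** From three pairs on, [i = j]: otherwise [x = y] would lie in both sets of a third pair. All
    other pairs then have [y] in [A p] and [x] in [B p], and both sizes at least 2, so they add at
    most 1/3 to the 1/2 of pair [i]. *)
Lemma fsum_singletons J A B i j : cross J A B -> (1 < #|J|)%N -> admissible J A B ->
  i \in J -> j \in J -> #|A i| = 1%N -> #|B j| = 1%N -> fsum J A B <= 5 / 6.
Proof.
move=> crs J1 adm iJ jJ /eqP/cards1P[x Ai] /eqP/cards1P[y Bj].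
case: (eqVneq #|J| 2%N) => [J2|J2]; first exact: fsum_pair.
have third p q : exists2 r, r \in J & (r != p) && (r != q).
  have : (0 < #|J :\ p :\ q|)%N.
    have := cardsD1 q (J :\ p); have := cardsD1 p J.
    case: (p \in J); case: (q \in J :\ p); lia.
  by case/card_gt0P=> r; rewrite !inE => /and3P[rq rp rJ]; exists r; rewrite // rp.
have xB p : p \in J -> p != i -> x \in B p.
  by move=> pJ pi; have [|t] := cross_meet crs iJ pJ; rewrite 1?eq_sym // Ai inE => /eqP->.
have yA p : p \in J -> p != j -> y \in A p.
  by move=> pJ pj; have [//|t tA] := cross_meet crs pJ jJ; rewrite Bj inE => /eqP <-.
have [ij|ij] := eqVneq i j; last first.
  have : x \in B j by apply: xB; rewrite // eq_sym.
  rewrite Bj inE => /eqP E; have [r rJ /andP[ri rj]] := third i j.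
  by case: (cross_disjoint crs rJ (yA r rJ rj)); rewrite -E; apply: xB.
move: yA Bj; rewrite -{}ij => yA Bi {j jJ}.
rewrite (fsumD1 A B iJ) Ai Bi !cards1.
have RP p : p \in J :\ i -> p \in J /\ p != i by case/setD1P.
have big p : p \in J :\ i -> (2 <= #|A p|)%N /\ (2 <= #|B p|)%N.
  move=> /RP[pJ pi]; have [r rJ /andP[ri rp]] := third i p.
  have pr : p != r by rewrite eq_sym.
  split; apply/card_gt1P.
    have [t tA tB] := cross_meet crs pJ rJ pr; exists t, y; split; rewrite ?yA //.
    by apply/eqP => E; case: (cross_disjoint crs rJ (yA r rJ ri)); rewrite -E.
  have [t tA tB] := cross_meet crs rJ pJ rp; exists t, x; split; rewrite ?xB //.
  by apply/eqP => E; case: (cross_disjoint crs rJ tA); rewrite E xB.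
have : fsum (J :\ i) A B <= 1%:R / 3%:R.
  have crsR := cross_sub (subD1set J i) crs.
  apply: (fsum_ratio (S := [set y]) (T := [set x]) crsR) => p pR.
  - by rewrite sub1set; have [pJ pi] := RP p pR; apply: yA.
  - by rewrite sub1set; have [pJ pi] := RP p pR; apply: xB.
  by rewrite !cards1; have [a2 b2] := big p pR; apply: wt_ratio11.
have := wt_le11 (leqnn 1) (leqnn 1); lra.
Qed.

(** Induction on the support, split by whether a singleton occurs on each side. A side without
    singletons allows passing to links unless it has a fork; what remains is two singletons, a
    singleton opposite a fork, or two opposite forks. *)
Lemma admissible_fsum J A B : cross J A B -> (1 < #|J|)%N -> admissible J A B ->
  fsum J A B <= 5 / 6.
Proof.
have [n] := ubnP #|supp J A B|;
elim: n J A B => [J A B|n IH J A B];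
  [by rewrite ltn0|rewrite ltnS => Sn crs J1 adm].
have supp_sym J' A' B' : supp J' A' B' = supp J' B' A'.
  by apply: eq_bigr => i _; rewrite setUC.
have crsS := cross_sym crs; have admS := admissible_sym adm.
have size2 (C : I -> {set V}) : (forall i, i \in J -> C i != set0) ->
    ~~ [exists i in J, #|C i| == 1%N] -> forall i, i \in J -> (2 <= #|C i|)%N.
  move=> C0 /exists_inPn C1 i iJ.
  by rewrite ltn_neqAle eq_sym C1 // card_gt0 C0.
have A0 i : i \in J -> A i != set0 by apply: (cross_neq0 crs).
have B0 i : i \in J -> B i != set0 by apply: (cross_neq0 crsS).
have stepA : (forall i, i \in J -> (2 <= #|A i|)%N) -> ~~ has_fork J A B ->
    fsum J A B <= 5 / 6.
  move=> A2 nf; apply: (link_step crs J1 adm A2 nf) => J' A' lt.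
  by apply: IH; apply: leq_trans lt Sn.
have stepB : (forall i, i \in J -> (2 <= #|B i|)%N) -> ~~ has_fork J B A ->
    fsum J A B <= 5 / 6.
  move=> B2 nf; rewrite fsum_sym; apply: (link_step crsS J1 admS B2 nf) => J' A' lt.
  by apply: IH; apply: leq_trans lt _; rewrite supp_sym.
case: (boolP [exists i in J, #|A i| == 1%N]) => [/exists_inP[i iJ /eqP Ai]|/(size2 A A0) A2];
  case: (boolP [exists j in J, #|B j| == 1%N]) => [/exists_inP[j jJ /eqP Bj]|/(size2 B B0) B2].
- exact: fsum_singletons adm iJ jJ Ai Bj.
- case: (boolP (has_fork J B A)) => [/(has_forkP crsS)|]; last exact: stepB.
  move=> [k [l [x [y [z [w G]]]]]]; rewrite fsum_sym.
  exact: fork_with_singleton crsS G B2 iJ Ai.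
- case: (boolP (has_fork J A B)) => [/(has_forkP crs)|]; last exact: stepA.
  by move=> [k [l [x [y [z [w F]]]]]]; apply: fork_with_singleton crs F A2 jJ Bj.
case: (boolP (has_fork J A B)) => [/(has_forkP crs)|]; last exact: stepA.
case: (boolP (has_fork J B A)) => [/(has_forkP crsS)|]; last by move=> nf _; apply: stepB.
move=> [i [j [x' [y' [z' [w' G]]]]]] [k [l [x [y [z [w F]]]]]].
by apply: two_forks crs F G _ => p pJ; split; [apply: A2|apply: B2].
Qed.

End SetPairs.

(** * Transfer to finite subsets of an arbitrary choice type *)

Local Open Scope fset_scope.
Local Open Scope ring_scope.

Theorem theorem1p6 (K : choiceType) (m : nat) (hm : (2 <= m)%N)
    (A B : 'I_m -> {fset K}) (hAB : one_cross_intersecting A B)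
    (a b : 'I_m -> nat)
    (ha : forall i : 'I_m, #|` A i| = a i)
    (hb : forall i : 'I_m, #|` B i| = b i)
    (hexc : ~ exists i j : 'I_m, (i < j)%N /\
       ((#|` A i| = 1%N /\ #|` A j| = 1%N /\ B i `&` B j <> fset0) \/
        (#|` B i| = 1%N /\ #|` B j| = 1%N /\ A i `&` A j <> fset0) \/
        (#|` A i| = 1%N /\ #|` A j| = 1%N /\
         #|` B i| = 1%N /\ #|` B j| = 1%N))) :
  \sum_(i < m) (1 / ('C(a i + b i, a i)%:R : rat)) <= 5%:R / 6%:R.
Proof.
(* The union of all the sets serves as the finite ground type. *)
have [dis one] := hAB; pose X := \bigcup_(i <- enum 'I_m) (A i `|` B i).
have sub i : A i `|` B i `<=` X by apply: bigfcup_sup; rewrite ?mem_enum.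
have AX i : A i `<=` X := fsubset_trans (fsubsetUl _ _) (sub i).
have BX i : B i `<=` X := fsubset_trans (fsubsetUr _ _) (sub i).
have neq0 (C D : {fset K}) : C `<=` X -> fsub X C :&: fsub X D != set0 -> C `&` D <> fset0.
  by move=> CX; rewrite -fsubI => /negP h E; apply: h; rewrite E fsub0.
have crs : cross [set: 'I_m] (fun i => fsub X (A i)) (fun i => fsub X (B i)).
  split=> [i _|i j _ _ /eqP ij]; rewrite -fsubI ?dis ?fsub0 //.
  by rewrite card_fsub ?one // (fsubset_trans (fsubsetIl _ _)).
have -> : \sum_(i < m) (1 / ('C(a i + b i, a i)%:R : rat)) =
    fsum [set: 'I_m] (fun i => fsub X (A i)) (fun i => fsub X (B i)).
  rewrite /fsum [RHS](eq_bigl predT) => [|i]; last by rewrite in_setT.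
  by apply: eq_bigr => i _; rewrite !card_fsub // ha hb div1r.
apply: admissible_fsum => [||i j _ _]; [exact: crs|by rewrite cardsT card_ord|].
rewrite !card_fsub // => ij; have {ij} : (i < j)%N || (j < i)%N by rewrite -neq_ltn.
case/orP=> lt; split=> -[].
- by move=> Ai Aj /(neq0 _ _ (BX i)) BB; apply: hexc; exists i, j; split=> //; left.
- by move=> Bi Bj /(neq0 _ _ (AX i)) AA; apply: hexc; exists i, j; split=> //; right; left.
- by move=> Ai Aj Bi Bj; apply: hexc; exists i, j; split=> //; right; right.
- move=> Ai Aj; rewrite setIC => /(neq0 _ _ (BX j)) BB.
  by apply: hexc; exists j, i; split=> //; left.
- move=> Bi Bj; rewrite setIC => /(neq0 _ _ (AX j)) AA.
  by apply: hexc; exists j, i; split=> //; right; left.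
by move=> Ai Aj Bi Bj; apply: hexc; exists j, i; split=> //; right; right.
Qed.
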